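(* Let $B$ be a set of positive roots of $A_\infty$. Then $B$ is biclosed if and only if $B=N(\prec)$ for some total order $\prec$ on $\mathbb{Z}$, where $N(\prec)=\{\beta_{ij}: i<j,\ i\succ j\}$.
   Context: The positive roots of $A_\infty$ (the group of finitely supported permutations of $\mathbb{Z}$) are $\Phi^+=\{\beta_{ij}=e_j-e_i:i<j\}$ in the real vector space with basis $e_i$, $i\in\mathbb{Z}$; $<$ is the usual order on $\mathbb{Z}$. A subset $B\subseteq\Phi^+$ is biclosed if for all $\alpha,\beta,\gamma\in\Phi^+$ with $\gamma\in\mathbb{R}_{>0}\alpha+\mathbb{R}_{>0}\beta$: $\alpha,\beta\in B\Rightarrow\gamma\in B$, and $\alpha,\beta\notin B\Rightarrow\gamma\notin B$. *)

(* Defs.v *)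
From mathcomp Require Export all_boot all_order all_algebra.
From mathcomp Require Export boolp classical_sets reals.
From mathcomp.multinomials Require Export freeg.

Set Implicit Arguments.
Unset Strict Implicit.
Unset Printing Implicit Defensive.

Import Order.TTheory GRing.Theory Num.Theory.

Local Open Scope classical_set_scope.
Local Open Scope ring_scope.

(* The real vector space with basis (e_i), i an integer. *)
Definition root_space (R : realType) : lmodType R := {freeg int / R}.

Definition e (R : realType) (i : int) : root_space R := << i >>.

Definition beta (R : realType) (i j : int) : root_space R := e R j - e R i.

Definition positive_roots (R : realType) : set (root_space R) :=
  [set v | exists i j : int, i < j /\ v = beta R i j].

Arguments positive_roots : clear implicits.

Definition biclosed (R : realType) (B : set (root_space R)) : Prop :=
  forall u v w : root_space R,
    positive_roots R u -> positive_roots R v -> positive_roots R w ->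
    (exists a b : R, [/\ 0 < a, 0 < b & w = a *: u + b *: v]) ->
    (B u -> B v -> B w) /\ (~ B u -> ~ B v -> ~ B w).

(* Total orders are given by their strict part. *)
Definition strict_total_order (T : eqType) (prec : rel T) : Prop :=
  [/\ irreflexive prec, transitive prec
    & forall x y : T, x != y -> prec x y || prec y x].

Definition inversions (R : realType) (prec : rel int) : set (root_space R) :=
  [set v | exists i j : int, [/\ i < j, prec j i & v = beta R i j]].

Arguments inversions : clear implicits.

(* Main.v *)
(* Comparing coefficients, a positive root that is a positive combination of two
   positive roots is either equal to the first of them or is [beta i k], the two
   roots being [beta i j] and [beta j k] in some order. So biclosedness only
   concerns triples i < j < k, where it says exactly that the relation obtained
   from the usual order by reversing the pairs in B is transitive. *)
Require Import Defs.
From mathcomp Require Import lra.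

Set Implicit Arguments.
Unset Strict Implicit.
Unset Printing Implicit Defensive.

Import Order.TTheory GRing.Theory Num.Theory.

Local Open Scope classical_set_scope.
Local Open Scope ring_scope.

Lemma coeff_beta (R : realType) (t i j : int) :
  coeff t (beta R i j) = (j == t)%:R - (i == t)%:R.
Proof. by rewrite /beta /e coeffB !coeffU !mul1r. Qed.

(** The sign of a coefficient locates an endpoint. No order on [i] and [j] is assumed: for [i = j]
    all coefficients vanish. *)
Lemma coeff_beta_gt0 (R : realType) (t i j : int) :
  0 < coeff t (beta R i j) -> j = t.
Proof.
by rewrite coeff_beta; case: eqP => // _; case: eqP => _ /= ?; exfalso; lra.
Qed.

Lemma coeff_beta_lt0 (R : realType) (t i j : int) :
  coeff t (beta R i j) < 0 -> i = t.
Proof.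
by rewrite coeff_beta; case: (i =P t) => // _; case: eqP => _ /= ?; exfalso; lra.
Qed.

Lemma beta_add (R : realType) (i j k : int) :
  beta R i k = beta R i j + beta R j k.
Proof. by rewrite /beta [RHS]addrC subrKA. Qed.

Lemma beta_inj (R : realType) (i j m n : int) :
  i < j -> beta R i j = beta R m n -> m = i /\ n = j.
Proof.
move=> ij E; split; [apply: (@coeff_beta_lt0 R _ _ n)|
  apply: (@coeff_beta_gt0 R _ m)]; rewrite -E coeff_beta eqxx.
- by rewrite (gt_eqF ij) /=; lra.
- by rewrite (lt_eqF ij) /=; lra.
Qed.

(* An endpoint of [beta i j] or [beta k l] that does not cancel in the
   combination must be an endpoint of [beta m n]. *)
Lemma positive_comb_beta (R : realType) (a b : R) (i j k l m n : int) :
  i < j -> k < l -> 0 < a -> 0 < b ->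
  beta R m n = a *: beta R i j + b *: beta R k l ->
  [\/ m = i /\ n = j, [/\ j = k, m = i & n = l] | [/\ l = i, m = k & n = j]].
Proof.
move=> ij kl a0 b0 E.
have C t : coeff t (beta R m n) =
    a * ((j == t)%:R - (i == t)%:R) + b * ((l == t)%:R - (k == t)%:R).
  by rewrite E coeffD !coeffZ !coeff_beta.
have [jk|jk] := eqVneq j k.
  subst k; apply: Or32; split=> //;
    [apply: (@coeff_beta_lt0 R _ _ n)|apply: (@coeff_beta_gt0 R _ m)];
    rewrite C !eqxx.
  - by rewrite (gt_eqF ij) (gt_eqF (lt_trans ij kl)) /=; lra.
  - by rewrite (lt_eqF kl) (lt_eqF (lt_trans ij kl)) /=; lra.
have [li|li] := eqVneq l i.
  subst l; apply: Or33; split=> //;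
    [apply: (@coeff_beta_lt0 R _ _ n)|apply: (@coeff_beta_gt0 R _ m)];
    rewrite C !eqxx.
  - by rewrite (gt_eqF kl) (gt_eqF (lt_trans kl ij)) /=; lra.
  - by rewrite (lt_eqF ij) (lt_eqF (lt_trans kl ij)) /=; lra.
(* Without cancellation the coefficient is [-a] or [-a - b] at [i], and [a] or [a + b] at [j]. *)
apply: Or31; split;
  [apply: (@coeff_beta_lt0 R _ _ n)|apply: (@coeff_beta_gt0 R _ m)];
  rewrite C !eqxx.
- by rewrite (gt_eqF ij) (negbTE li); case: (k == i) => /=; lra.
- by rewrite (lt_eqF ij) [k == j]eq_sym (negbTE jk); case: (l == j) => /=; lra.
Qed.

Lemma biclosedP (R : realType) (B : set (root_space R)) :
  biclosed B <-> forall i j k : int, i < j -> j < k ->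
    (B (beta R i j) -> B (beta R j k) -> B (beta R i k)) /\
    (~ B (beta R i j) -> ~ B (beta R j k) -> ~ B (beta R i k)).
Proof.
split=> [biB i j k ij jk|H u v w [i [j [ij ->]]] [k [l [kl ->]]]].
  apply: biB.
  - by exists i, j.
  - by exists j, k.
  - by exists i, k; rewrite (lt_trans ij jk).
  - by exists 1, 1; rewrite !scale1r -beta_add.
move=> [m [n [_ ->]]] [a [b [a0 b0]]].
(* In the first case [w] is [u], so both implications are trivial. *)
case/(positive_comb_beta ij kl a0 b0) => [[-> ->]//|[jk -> ->]|[li -> ->]].
- by subst k; apply: H.
- by subst l; have [? ?] := H _ _ _ kl ij; split=> ? ?; auto.
Qed.

Lemma inversions_beta (R : realType) (prec : rel int) (i j : int) :
  i < j -> inversions R prec (beta R i j) <-> prec j i.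
Proof.
move=> ij; split=> [[m [n [_ nm]]] /(beta_inj ij) [<- <-]//|ji].
by exists i, j.
Qed.

(** Closure is transitivity along [k], [j], [i]. By totality, non-inversions are pairs that [prec]
    orders as usual, so coclosure is transitivity along [i], [j], [k]. *)
Lemma biclosed_inversions (R : realType) (prec : rel int) :
  strict_total_order prec -> biclosed (inversions R prec).
Proof.
move=> [irr tr tot]; apply/biclosedP => i j k ij jk.
have flip x y : x < y -> ~ prec y x -> prec x y.
  by move=> /lt_eqF/negbT/tot/orP[].
rewrite !inversions_beta ?(lt_trans ij jk) //; split=> [ji kj|nji nkj ki].
  exact: tr kj ji.
have /(tr _ _ _ ki) kk := tr _ _ _ (flip _ _ ij nji) (flip _ _ jk nkj).
by move: kk; rewrite irr.
Qed.

Definition root_order (R : realType) (B : set (root_space R)) : rel int :=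
  fun x y => (x < y) && ~~ `[< B (beta R x y) >] ||
             (y < x) && `[< B (beta R y x) >].

Lemma root_order_strict_total (R : realType) (B : set (root_space R)) :
  biclosed B -> strict_total_order (root_order B).
Proof.
move=> /biclosedP bi; split=> [x|y x z|x y xy]; rewrite /root_order;
  last 1 first.
- by move: xy; rewrite neq_lt => /orP[] h; rewrite h (lt_gtF h) /=;
    case: asboolP.
- by rewrite ltxx.
(* Transitivity is checked for each relative position of [x], [y], [z]; positions contradicting
   transitivity of [<] are discarded first. *)
- have [xy|yx|->] := ltgtP x y; have [yz|zy|->] := ltgtP y z;
    have [xz|zx|?] := ltgtP x z => //=; subst => //; rewrite ?orbF ?ltxx //=.
  all: try by move: (lt_trans xy yz); rewrite ltNge le_eqVlt ?zx ?eqxx ?orbT.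
  all: try by move: (lt_trans zy yx); rewrite ltNge le_eqVlt ?xz ?eqxx ?orbT.
  all: do ?case: asboolP => //.
  (* Each of the six orderings of distinct [x], [y], [z] admits exactly one of these instances, the
     one for its increasing chain. *)
  all: try have := bi _ _ _ xy yz; try have := bi _ _ _ zy yx.
  all: try have := bi _ _ _ xz zy; try have := bi _ _ _ yx xz.
  all: try have := bi _ _ _ yz zx; try have := bi _ _ _ zx xy.
  all: tauto.
Qed.

(** [root_order] tests [B] only on positive roots, so it recovers [B] because [B] consists of such
    roots. *)
Lemma inversions_root_order (R : realType) (B : set (root_space R)) :
  B `<=` positive_roots R -> inversions R (root_order B) = B.
Proof.
move=> hB; have E i j : i < j -> root_order B j i = `[< B (beta R i j) >].
  by move=> ij; rewrite /root_order ij (lt_gtF ij).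
apply/seteqP; split=> v; first by move=> [i [j [ij]]]; rewrite E// => /asboolP ? ->.
move=> Bv; have [i [j [ij vE]]] := hB _ Bv.
by exists i, j; split=> //; rewrite E //; apply/asboolP; rewrite -vE.
Qed.

Theorem theorem5p4 (R : realType) (B : set (root_space R))
    (hB : B `<=` positive_roots R) :
  biclosed B <->
  exists prec : rel int, strict_total_order prec /\ B = inversions R prec.
Proof.
split=> [biB|[prec [tot ->]]]; last exact: biclosed_inversions.
by exists (root_order B); rewrite inversions_root_order //; split=> //;
  apply: root_order_strict_total.
Qed.
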